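(* Every completely monotone kernel $G:\mathbb{R}_+\to\mathbb{R}_+$ with $G(0)>0$ preserves nonnegativity. More generally, if $\mu$ is a nonzero finite (nonnegative) Borel measure on $\mathbb{R}$ such that $G(t)=\int_{\mathbb{R}}e^{-\rho t}\mu(d\rho)<\infty$ for all $t\ge 0$, then $G$ preserves nonnegativity. Besides, if $G(t)=\int_{\mathbb{R}}e^{-\rho t}\mu(d\rho)$ is such a kernel and $\mu$ is not concentrated on a single point (i.e. $\mu$ is not of the form $\lambda\delta_{\rho_1}$ with $\lambda>0$, $\rho_1\in\mathbb{R}$), then for any $K\in\mathbb{N}^*$, any $x_1,\dots,x_K\in\mathbb{R}$ and any $0\le t_1<\dots<t_K$ such that $x_1>0$ and $\sum_{k'=1}^k x_{k'}G(t_k-t_{k'})\ge 0$ for all $k\in\{1,\dots,K\}$, one has $$\sum_{k:\,t_k\le t}x_kG(t-t_k)>0\quad\text{for all } t>t_1,\ t\notin\{t_2,\dots,t_K\}.$$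
   Context: Notation: $\mathbb{R}_+=[0,\infty)$, $\mathbb{R}_+^*=(0,\infty)$, $\mathbb{N}^*=\{1,2,\dots\}$. Nonnegativity preserving kernel: a function (kernel) $G:\mathbb{R}_+\to\mathbb{R}_+$ with $G(0)>0$ is said to preserve nonnegativity if, for any $K\in\mathbb{N}^*$, any $x_1,\dots,x_K\in\mathbb{R}$ and any $0\le t_1<\dots<t_K$ such that $\sum_{k'=1}^k x_{k'}G(t_k-t_{k'})\ge 0$ for all $k\in\{1,\dots,K\}$, one has $\sum_{k:\,t_k\le t}x_kG(t-t_k)\ge 0$ for all $t\ge 0$ (an empty sum is $0$). Completely monotone kernel: $G:\mathbb{R}_+^*\to\mathbb{R}_+$ is completely monotone if it is $\mathcal{C}^\infty$ on $\mathbb{R}_+^*$ and $(-1)^nG^{(n)}\ge 0$ for all $n\in\mathbb{N}$; equivalently, $G(t)=\int_{[0,\infty)}e^{-\rho t}\mu(d\rho)$ for a Borel measure $\mu$ on $\mathbb{R}_+$. When $\lim_{t\to0+}G(t)<\infty$ (i.e. $\mu$ is finite), $G$ is extended to $\mathbb{R}_+$ by $G(0)=\lim_{t\to0+}G(t)$, and one writes $G:\mathbb{R}_+\to\mathbb{R}_+$. *)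

(* Defs.v *)
From HB Require Import structures.
From mathcomp Require Import all_boot all_order all_algebra.
From mathcomp Require Import all_classical all_reals all_analysis.
Set Implicit Arguments.
Unset Strict Implicit.
Unset Printing Implicit Defensive.
Import Order.TTheory GRing.Theory Num.Theory.
Import numFieldNormedType.Exports.
Local Open Scope classical_set_scope.
Local Open Scope ring_scope.

(* A kernel [0, +oo[ -> [0, +oo[ is a total function R -> R whose values at
   negative arguments are irrelevant: every definition below only evaluates
   (or differentiates) it on [0, +oo[.
   A nonempty family x_1, ..., x_K is a function on 'I_K.+1, indexed from 0. *)

Definition positive_at_0_kernel (R : realType) (G : R -> R) : Prop :=
  (forall t, 0 <= t -> 0 <= G t) /\ 0 < G 0.

Definition increasing_times (R : realType) (K : nat) (t : 'I_K.+1 -> R) : Prop :=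
  0 <= t ord0 /\ forall i j : 'I_K.+1, (i < j)%N -> t i < t j.

Definition nonneg_at_times (R : realType) (G : R -> R) (K : nat)
    (x t : 'I_K.+1 -> R) : Prop :=
  forall k : 'I_K.+1,
    0 <= \sum_(k' < K.+1 | (k' <= k)%N) x k' * G (t k - t k').

Definition kernel_sum (R : realType) (G : R -> R) (K : nat)
    (x t : 'I_K.+1 -> R) (s : R) : R :=
  \sum_(k < K.+1 | t k <= s) x k * G (s - t k).

Definition preserves_nonneg (R : realType) (G : R -> R) : Prop :=
  positive_at_0_kernel G /\
  forall (K : nat) (x t : 'I_K.+1 -> R),
    increasing_times t -> nonneg_at_times G x t ->
    forall s, 0 <= s -> 0 <= kernel_sum G x t s.

(* The derivatives at t > 0 depend only on the values of G near t, hence only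
   on its restriction to ]0, +oo[; differentiability at every order is
   C^infinity. The case n = 0 of the sign condition is G >= 0. *)
Definition completely_monotone (R : realType) (G : R -> R) : Prop :=
  forall (n : nat) (t : R), 0 < t ->
    derivable (derive1n n G) t 1 /\ 0 <= (- 1) ^+ n * derive1n n G t.

Definition completely_monotone_kernel (R : realType) (G : R -> R) : Prop :=
  completely_monotone G /\ G x @[x --> 0^'+] --> G 0.

(* G t is real, so the equality includes the finiteness of the integral. *)
Definition laplace_kernel (R : realType)
    (mu : set (measurableTypeR R) -> \bar R) (G : R -> R) : Prop :=
  forall t : R, 0 <= t ->
    (\int[mu]_(rho in [set: measurableTypeR R]) (expR (- rho * t))%:E)%E
      = (G t)%:E.

Definition concentrated_at_point (R : realType)
    (mu : set (measurableTypeR R) -> \bar R) : Prop :=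
  exists (lambda : R) (rho1 : measurableTypeR R), 0 < lambda /\
    forall A : set (measurableTypeR R), measurable A ->
      mu A = (lambda%:E * dirac rho1 A)%E.

(* Main.v *)
(* The proof rests on log-convexity, [G (a + d) G b <= G a G (b + d)] for
   [a <= b]. For times [t_1 < ... < t_K < s], backward recursion on [j] solves
   [G (s - t_j) = sum_(i >= j) w_i G (t_i - t_j)], and log-convexity makes every
   weight [w_i] nonnegative (this is Kaluza's argument on the inverse of a
   log-convex power series, for irregular times). Hence the kernel sum at [s] is
   [sum_i w_i y_i] with [y_i >= 0] its values at the times [t_i]; strict
   log-convexity gives [w_1 > 0], and [y_1 = x_1 G 0].

   Laplace transforms are log-convex by Chebyshev's sum inequality. Completely
   monotone functions are log-convex without recourse to Bernstein's theorem:
   [f'^2 <= c f f''] holds with [c = 2] by Taylor's formula, and the inequality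
   with constant [c] for [- f'] gives the one with constant [2 - 1 / c] for [f];
   the constants [2, 3/2, 4/3, ...] so obtained tend to [1]. *)
Require Import Defs.
From HB Require Import structures.
From mathcomp Require Import all_boot all_order all_algebra.
From mathcomp Require Import all_classical all_reals all_analysis.
From mathcomp Require Import measurable_realfun ring lra.
Import Order.TTheory GRing.Theory Num.Theory.
Import numFieldNormedType.Exports.
Local Open Scope classical_set_scope.
Local Open Scope ring_scope.

(** * Nonnegativity from log-convexity *)

(** For positive [G] this says, without division, that [G (t + d) / G t] is nondecreasing in
    [t >= 0]. *)
Definition log_convex {R : realType} (G : R -> R) : Prop :=
  forall a b d, 0 <= a -> a <= b -> 0 <= d ->
    G (a + d) * G b <= G a * G (b + d).

Definition strictly_log_convex {R : realType} (G : R -> R) : Prop :=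
  forall a b d, 0 <= a -> a < b -> 0 < d ->
    G (a + d) * G b < G a * G (b + d).

(** The equation for [j] involves only the weights [w i] with [i >= j], so the induction drops the
    earliest time, keeps the weights of the later ones and solves for one new weight. *)
Lemma log_convex_weights {R : realType} {G : R -> R}
    (G_gt0 : forall t, 0 <= t -> 0 < G t) (Glc : log_convex G)
    {n : nat} {t : nat -> R} {s : R} :
  (forall i j, (i < j <= n)%N -> t i < t j) -> t n < s ->
  exists w : nat -> R,
    [/\ forall i, (i <= n)%N -> 0 <= w i,
        strictly_log_convex G -> forall i, (i <= n)%N -> 0 < w i
      & forall j, (j <= n)%N ->
          G (s - t j) = \sum_(j <= i < n.+1) w i * G (t i - t j)].
Proof.
elim: n t => [|n IHn] t t_incr t_lt_s.
  have Gs_gt0 : 0 < G (s - t 0%N) / G 0.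
    by rewrite divr_gt0 ?G_gt0 ?subr_ge0 // ltW.
  exists (fun=> G (s - t 0%N) / G 0); split=> [i _|_ i _|j] //; first exact: ltW.
  rewrite leqn0 => /eqP ->.
  by rewrite big_nat1 subrr divfK// gt_eqF ?G_gt0.
have tS_incr i j : (i < j <= n)%N -> t i.+1 < t j.+1 by move=> ?; apply: t_incr.
have [w [w_ge0 w_gt0 wE]] := IHn (fun i => t i.+1) tS_incr t_lt_s.
have t_le i j : (i <= j <= n.+1)%N -> t i <= t j.
  case/andP; rewrite leq_eqVlt => /predU1P[-> //|ij jn].
  by rewrite ltW// t_incr// ij.
have t01 : t 0%N < t 1%N by exact: t_incr.
have t1s : t 1%N < s by apply: le_lt_trans t_lt_s; rewrite t_le//= leqnn.
set d := t 1%N - t 0%N; have d_gt0 : 0 < d by rewrite subr_gt0.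
have shift u : u - t 0%N = u - t 1%N + d by rewrite /d; ring.
have G0_gt0 : 0 < G 0 by exact: G_gt0.
have G1_gt0 : 0 < G (s - t 1%N) by rewrite G_gt0 ?subr_ge0 // ltW.
pose r := G (s - t 0%N) - \sum_(0 <= i < n.+1) w i * G (t i.+1 - t 0%N).
(* The other factor [G (s - t 1)] is expanded by the induction hypothesis at [j = 0]. Each
   difference is then signed by log-convexity between [t i.+1 - t 1] and [s - t 1], with increment
   [d]. *)
have rE : r * G (s - t 1%N) = \sum_(0 <= i < n.+1) w i *
    (G (t i.+1 - t 1%N) * G (s - t 0%N) - G (t i.+1 - t 0%N) * G (s - t 1%N)).
  under eq_bigr do rewrite mulrBr !mulrA.
  by rewrite sumrB -!mulr_suml -(wE 0%N)// /r mulrBl [G (s - t 1%N) * _]mulrC.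
have term_ge0 i : (i <= n)%N -> 0 <= w i *
    (G (t i.+1 - t 1%N) * G (s - t 0%N) - G (t i.+1 - t 0%N) * G (s - t 1%N)).
  move=> i_n; rewrite mulr_ge0 ?w_ge0// subr_ge0 !(shift _) Glc ?(ltW d_gt0)//.
    by rewrite subr_ge0 t_le.
  by rewrite lerD2r ltW//; apply: le_lt_trans t_lt_s; rewrite t_le// ltnS i_n leqnn.
exists (fun i => if i is i'.+1 then w i' else r / G 0); split.
- move=> [_|i]; last by rewrite ltnS; exact: w_ge0.
  rewrite divr_ge0 ?(ltW G0_gt0)// -(pmulr_lge0 _ G1_gt0) rE big_nat_cond sumr_ge0// => i.
  by rewrite andbT => /andP[_]; exact: term_ge0.
- move=> Gslc [_|i]; last by rewrite ltnS; exact: w_gt0.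
  (* One strictly positive term suffices: the one for [i = 0]. *)
  rewrite divr_gt0// -(pmulr_lgt0 _ G1_gt0) rE big_nat_recl//.
  rewrite ltr_pwDl//; last first.
    rewrite big_nat_cond sumr_ge0// => i.
    by rewrite andbT => /andP[_]; exact: term_ge0.
  rewrite mulr_gt0 ?w_gt0// subr_gt0 !(shift _) Gslc// ?ltrD2r//.
  by rewrite subr_ge0 t_le.
- move=> [_|j]; last by rewrite ltnS big_add1 => /wE.
  by rewrite big_nat_recl//= subrr divfK ?gt_eqF// /r subrK.
Qed.

Lemma log_convex_sum {R : realType} {G : R -> R}
    (G_gt0 : forall t, 0 <= t -> 0 < G t) (Glc : log_convex G)
    {n : nat} {x t : nat -> R} {s : R} :
  (forall i j, (i < j <= n)%N -> t i < t j) -> t n < s ->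
  (forall k, (k <= n)%N -> 0 <= \sum_(i < k.+1) x i * G (t k - t i)) ->
  0 <= \sum_(i < n.+1) x i * G (s - t i)
  /\ (strictly_log_convex G -> 0 < x 0%N ->
      0 < \sum_(i < n.+1) x i * G (s - t i)).
Proof.
move=> t_incr t_lt_s y_ge0.
have [w [w_ge0 w_gt0 wE]] := log_convex_weights G_gt0 Glc t_incr t_lt_s.
have -> : \sum_(i < n.+1) x i * G (s - t i) =
    \sum_(i < n.+1) w i * \sum_(k < i.+1) x k * G (t i - t k).
  transitivity (\sum_(k < n.+1) \sum_(i < n.+1 | (k <= i)%N)
      w i * (x k * G (t i - t k))).
    apply: eq_bigr => k _; rewrite wE; last by rewrite -ltnS.
    by rewrite big_geq_mkord mulr_sumr; apply: eq_bigr => i _; rewrite mulrCA.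
  rewrite (exchange_big_dep predT)//=; apply: eq_bigr => i _.
  by rewrite (big_ord_widen n.+1 (fun k => x k * G (t i - t k)))// mulr_sumr.
have term_ge0 (i : 'I_n.+1) :
    0 <= w i * \sum_(k < i.+1) x k * G (t i - t k).
  by rewrite mulr_ge0 ?w_ge0 ?y_ge0// -ltnS.
split=> [|Gslc x0_gt0]; first exact: sumr_ge0.
rewrite big_ord_recl ltr_pwDl ?sumr_ge0// big_ord1 subrr.
by rewrite !mulr_gt0 ?w_gt0 ?G_gt0.
Qed.

(** Before [t ord0] the sum is empty; at one of the times it is an assumed value; otherwise
    [log_convex_sum] applies to the times preceding [s]. *)
Lemma log_convex_kernel_sum {R : realType} {G : R -> R}
    (G_gt0 : forall t, 0 <= t -> 0 < G t) (Glc : log_convex G)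
    {K : nat} {x t : 'I_K.+1 -> R} (s : R) :
  increasing_times t -> nonneg_at_times G x t ->
  0 <= kernel_sum G x t s
  /\ (strictly_log_convex G -> 0 < x ord0 -> t ord0 < s ->
      (forall k : 'I_K.+1, k != ord0 -> s != t k) -> 0 < kernel_sum G x t s).
Proof.
move=> [_ t_incr] y_ge0.
have t_le (i j : 'I_K.+1) : (i <= j)%N -> t i <= t j.
  by rewrite leq_eqVlt => /predU1P[/val_inj-> //|ij]; rewrite ltW// t_incr.
have [t0s|s_lt_t0] := leP (t ord0) s; last first.
  rewrite /kernel_sum big_pred0.
    by split=> // _ _ /lt_trans - /(_ _ s_lt_t0); rewrite ltxx.
  by move=> i; apply/negbTE; rewrite -ltNge (lt_le_trans s_lt_t0)// t_le.
have [m tms m_max] := @arg_maxnP _ ord0 (fun i => t i <= s) val t0s.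
have ksE : kernel_sum G x t s =
    \sum_(k < K.+1 | (k <= m)%N) x k * G (s - t k).
  apply: eq_bigl => k; apply/idP/idP => [/m_max//|km].
  by rewrite (le_trans (t_le _ _ km)).
(* [inord] turns the families into sequences on [nat]; only indices up to [m <= K] are read, where
   it is faithful. *)
have widen k u : (k <= m)%N -> \sum_(i < k.+1) x (inord i) * G (u - t (inord i))
    = \sum_(i < K.+1 | (i <= k)%N) x i * G (u - t i).
  move=> km; rewrite (big_ord_widen K.+1 (fun i => x (inord i) * G (u - t (inord i)))).
    by apply: eq_bigr => i _; rewrite inord_val.
  by rewrite ltnS (leq_trans km)// -ltnS.
have mK : (m <= K)%N by rewrite -ltnS.
move: tms; rewrite le_eqVlt => /predU1P[tms|tms].
  (* The strict claim excludes [s = t m], since [t ord0 < s] forces [m != ord0]. *)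
  rewrite ksE -tms; split=> [|_ _ t0m /(_ m)]; first exact: y_ge0.
  rewrite tms eqxx => /(_ _)/negP; case=> //.
  by apply: contraTneq t0m => ->; rewrite ltxx.
have := @log_convex_sum _ _ G_gt0 Glc m (fun i => x (inord i))
  (fun i => t (inord i)) s.
rewrite widen// -ksE inord_val => /(_ _ tms)[||].
- move=> i j /andP[ij jm]; apply: t_incr.
  by rewrite !inordK// ltnS ?(leq_trans (ltnW ij))// (leq_trans jm).
- move=> k km; rewrite widen//.
  by have := y_ge0 (inord k); rewrite inordK// ltnS (leq_trans km).
- move=> ks_ge0 ks_gt0; split=> // Gslc x0 _ _; apply: ks_gt0 => //.
  by rewrite [inord 0](_ : _ = ord0)//; apply/val_inj; rewrite /= inordK.
Qed.

Lemma log_convex_preserves_nonneg {R : realType} {G : R -> R} :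
  (forall t, 0 <= t -> 0 < G t) -> log_convex G -> preserves_nonneg G.
Proof.
move=> G_gt0 Glc; split; first by split=> [t /G_gt0/ltW //|]; exact: G_gt0.
move=> K x t t_incr y_ge0 s _.
by have [] := log_convex_kernel_sum G_gt0 Glc s t_incr y_ge0.
Qed.

(** * Laplace transforms of finite measures *)

(** Serves twice: for [f] without zeros it yields positivity of the transform; for [f] with at most
    one zero it shows that equality in Chebyshev's inequality concentrates [mu] at a point. *)
Lemma Rintegral_eq0_negligible {d} {T : measurableType d} {R : realType}
    {mu : {measure set T -> \bar R}} {f : T -> R} :
  mu.-integrable setT (EFin \o f) -> (forall x, 0 <= f x) ->
  \int[mu]_x f x = 0 -> mu.-negligible [set x | f x != 0].
Proof.
move=> intf f_ge0 f0.
have fE : (\int[mu]_x `|(EFin \o f) x|)%E = 0%E.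
  under eq_integral do rewrite /= ger0_norm//.
  rewrite -[LHS]fineK; first by move: f0; rewrite /Rintegral => ->.
  exact: integrable_fin_num.
have [A [mA muA0 subA]] :=
  (ae_eq_integral_abs mu measurableT (measurable_int mu intf)).1 fE.
exists A; split=> // x /= fx_neq0; apply: subA => /= /(_ I) [fx0].
by rewrite fx0 eqxx in fx_neq0.
Qed.

Section laplace.
Context {R : realType} {mu : {finite_measure set (measurableTypeR R) -> \bar R}}.
Context {G : R -> R}.
Hypotheses (mu_neq0 : mu setT <> 0%E) (muG : laplace_kernel mu G).

Let e (t : R) (rho : measurableTypeR R) : R := expR (- rho * t).

Lemma laplace_integrable {t : R} : 0 <= t -> mu.-integrable setT (EFin \o e t).
Proof.
move=> t_ge0; apply/integrableP; split.
  apply/measurable_EFinP; apply: measurableT_comp => //.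
  by apply: measurable_funM => //; exact: measurable_funN.
under eq_integral do rewrite /= ger0_norm ?expR_ge0//.
by rewrite muG// ltry.
Qed.

Lemma laplace_Rintegral {t : R} : 0 <= t -> \int[mu]_rho e t rho = G t.
Proof. by move=> t_ge0; rewrite /Rintegral muG. Qed.

Lemma laplace_gt0 {t : R} : 0 <= t -> 0 < G t.
Proof.
move=> t_ge0; rewrite -laplace_Rintegral// lt_def Rintegral_ge0 ?andbT; last first.
  by move=> *; exact: expR_ge0.
apply/eqP => e0; apply: mu_neq0; apply/negligibleP => //.
have := Rintegral_eq0_negligible (laplace_integrable t_ge0)
  (fun=> expR_ge0 _) e0.
apply: negligibleS => rho _ /=.
by rewrite gt_eqF ?expR_gt0.
Qed.

(* With [u = e^(-rho (b - a))], [v = e^(-rho d)] and [rho0] such that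
   [u rho0 = G b / G a], the function below is
   [e^(-rho a) (u - u rho0) (v - v rho0)], and its two factors have the same
   sign because [u] and [v] are both decreasing. *)
Lemma laplace_chebyshev {a b d : R} : 0 <= a -> a < b -> 0 < d ->
  exists (rho0 : R) (f : measurableTypeR R -> R),
    [/\ mu.-integrable setT (EFin \o f), forall rho, 0 <= f rho,
        forall rho, rho != rho0 -> f rho != 0 &
        \int[mu]_rho f rho = G (b + d) - G b / G a * G (a + d)].
Proof.
move=> a_ge0 ab d_gt0.
have Ga := laplace_gt0 a_ge0.
have b_ge0 : 0 <= b by rewrite (le_trans a_ge0)// ltW.
have Gb := laplace_gt0 b_ge0.
have ad_ge0 : 0 <= a + d by rewrite addr_ge0// ltW.
have bd_ge0 : 0 <= b + d by rewrite addr_ge0// ltW.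
have ba_gt0 : 0 < b - a by rewrite subr_gt0.
pose rho0 := - ln (G b / G a) / (b - a).
pose v0 := expR (- rho0 * d).
have uE : expR (- rho0 * (b - a)) = G b / G a.
  have -> : - rho0 * (b - a) = ln (G b / G a) by rewrite /rho0; field; rewrite gt_eqF.
  by rewrite lnK// posrE divr_gt0.
(* Expanded form, integrated by linearity: the choice of [rho0] makes the second bracket integrate
   to [v0 * (G b - G b / G a * G a) = 0]. *)
pose f rho := (e (b + d) rho - G b / G a * e (a + d) rho) -
  (v0 * e b rho - v0 * (G b / G a) * e a rho).
have fE rho : f rho = e a rho * ((e (b - a) rho - expR (- rho0 * (b - a))) *
    (e d rho - expR (- rho0 * d))).
  have eD s t : e (s + t) rho = e s rho * e t rho by rewrite /e mulrDr expRD.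
  have eb : e b rho = e a rho * e (b - a) rho by rewrite -eD subrKC.
  rewrite /f uE -/v0 (eD b) (eD a) eb; ring.
have mono rho s : 0 < s -> (e s rho < expR (- rho0 * s)) = (rho0 < rho).
  by move=> s_gt0; rewrite /e ltr_expR ltr_pM2r// ltrN2.
have iZ k t : 0 <= t -> mu.-integrable setT (EFin \o (fun rho => k * e t rho)).
  by move=> t_ge0; exact: (integrableZl measurableT k (laplace_integrable t_ge0)).
have i1 : mu.-integrable setT
    (EFin \o (fun rho => e (b + d) rho - G b / G a * e (a + d) rho)).
  exact: (integrableB measurableT (laplace_integrable bd_ge0) (iZ _ _ ad_ge0)).
have i2 : mu.-integrable setT
    (EFin \o (fun rho => v0 * e b rho - v0 * (G b / G a) * e a rho)).
  exact: (integrableB measurableT (iZ _ _ b_ge0) (iZ _ _ a_ge0)).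
exists rho0, f; split.
- exact: (integrableB measurableT i1 i2).
- move=> rho; rewrite fE mulr_ge0 ?expR_ge0//.
  have [lt0|le0] := ltP rho0 rho.
    by rewrite nmulr_rge0 ?subr_lt0 ?subr_le0 ?ltW ?mono.
  by rewrite mulr_ge0// subr_ge0 leNgt mono// -leNgt.
- move=> rho rho_neq.
  have neq t : t != 0 -> expR (- rho * t) != expR (- rho0 * t).
    move=> t_neq0; apply: contra rho_neq => /eqP/expR_inj/(mulIf t_neq0).
    by move=> /oppr_inj->.
  rewrite fE !mulf_eq0 !subr_eq0 !negb_or !neq ?gt_eqF ?expR_gt0//.
- rewrite RintegralB// RintegralB ?laplace_integrable ?iZ//.
  rewrite (@RintegralB _ _ _ mu setT (fun rho => v0 * e b rho)) ?iZ//.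
  rewrite !RintegralZl ?laplace_integrable// !laplace_Rintegral//.
  by field; rewrite gt_eqF.
Qed.

Lemma laplace_log_convex : log_convex G.
Proof.
move=> a b d a_ge0; rewrite le_eqVlt => /predU1P[->|ab].
  by rewrite mulrC.
rewrite le_eqVlt => /predU1P[<-|d_gt0]; first by rewrite !addr0.
have Ga := laplace_gt0 a_ge0.
have [_ [f [_ f_ge0 _ fE]]] := laplace_chebyshev a_ge0 ab d_gt0.
have : 0 <= \int[mu]_rho f rho by exact: Rintegral_ge0.
rewrite fE subr_ge0 mulrAC ler_pdivrMr//.
by rewrite mulrC [G (b + d) * _]mulrC.
Qed.

Lemma laplace_strictly_log_convex :
  ~ concentrated_at_point mu -> strictly_log_convex G.
Proof.
move=> mu_nc a b d a_ge0 ab d_gt0.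
have Ga := laplace_gt0 a_ge0.
have [rho0 [f [intf f_ge0 f_neq0 fE]]] := laplace_chebyshev a_ge0 ab d_gt0.
suff : 0 < \int[mu]_rho f rho.
  rewrite fE subr_gt0 mulrAC ltr_pdivrMr//.
  by rewrite mulrC [G (b + d) * _]mulrC.
rewrite lt_def Rintegral_ge0// andbT; apply/eqP => f0; apply: mu_nc.
have N0 : mu.-negligible [set~ (rho0 : measurableTypeR R)].
  apply: negligibleS (Rintegral_eq0_negligible intf f_ge0 f0) => rho /= /eqP.
  exact: f_neq0.
have muT_fin : mu setT \is a fin_num by exact: fin_num_measure.
exists (fine (mu setT)), rho0; split.
  by rewrite fine_gt0// lt0e measure_ge0 ltey_eq muT_fin !andbT; apply/eqP.
have mu0 A : measurable A -> ~ A rho0 -> mu A = 0%E.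
  move=> mA nA; apply/negligibleP => //; apply: negligibleS N0 => rho /= Arho rhoE.
  by apply: nA; rewrite -rhoE.
move=> A mA; rewrite fineK// diracE.
have [/set_mem Arho0|/negP nA] := boolP (rho0 \in A); last first.
  by rewrite mule0 mu0// => /mem_set.
rewrite mule1 -(setvU A) measureU//; last by rewrite setICl.
  by rewrite [X in (X + _)%E]mu0 ?add0e//; exact: measurableC.
exact: measurableC.
Qed.

End laplace.

(** * Log-convexity from the signs of the derivatives *)

Lemma is_derive1_ge0_le {R : realType} {f df : R -> R} {a b : R} : a <= b ->
  (forall t : R, a <= t -> is_derive t 1 f (df t)) ->
  (forall t : R, a <= t -> 0 <= df t) -> f a <= f b.
Proof.
move=> ab fdf df_ge0.
have [||c c_ab E] := @MVT_segment _ f df a b ab.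
- by move=> t; rewrite in_itv/= => /andP[/ltW + _]; exact: fdf.
- apply: derivable_within_continuous => t; rewrite in_itv/= => /andP[/fdf + _].
  by case.
move: c_ab; rewrite in_itv/= => /andP[ac _].
by rewrite -subr_ge0 E mulr_ge0 ?subr_ge0 ?df_ge0.
Qed.

(* [g n] stands for [(-1)^n f^(n)]; keeping the sequence abstract allows it to
   be perturbed by [e^(-t)], which makes it positive. *)
Definition cm_sequence {R : realType} (g : nat -> R -> R) : Prop :=
  forall n (t : R), 0 < t -> is_derive t 1 (g n) (- g n.+1 t) /\ 0 < g n t.

Section cm_sequence.
Context {R : realType}.

Lemma cm_sequence_le {g : nat -> R -> R} n {a b : R} : cm_sequence g ->
  0 < a -> a <= b -> g n b <= g n a.
Proof.
move=> gcm a_gt0 ab; rewrite -lerN2.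
apply: (@is_derive1_ge0_le _ (fun t => - g n t) (g n.+1) _ _ ab) => t at_.
  have t_gt0 := lt_le_trans a_gt0 at_.
  have [D _] := gcm n _ t_gt0.
  by apply: is_derive_eq; rewrite opprK.
by apply/ltW; apply: (gcm n.+1 t _).2; rewrite (lt_le_trans a_gt0).
Qed.

(* The remainder of the second Taylor polynomial has the sign of [- g n.+3 <= 0]. *)
Lemma cm_sequence_taylor2 {g : nat -> R -> R} n {a s : R} :
  cm_sequence g -> 0 < a -> 0 <= s ->
  g n (a + s) <= g n a - g n.+1 a * s + g n.+2 a * s ^+ 2 / 2.
Proof.
move=> gcm a_gt0 s_ge0.
(* [g n.+1] lies above its tangent at [a], because [g n.+2] is nonincreasing. *)
have le1 t : a <= t -> g n.+1 a - g n.+2 a * (t - a) <= g n.+1 t.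
  move=> at_.
  have := @is_derive1_ge0_le _ (fun t => g n.+1 t + g n.+2 a * (t - a))
    (fun t => - g n.+2 t + g n.+2 a) _ _ at_.
  have H : g n.+1 a + g n.+2 a * (a - a) <= g n.+1 t + g n.+2 a * (t - a) ->
    g n.+1 a - g n.+2 a * (t - a) <= g n.+1 t by lra.
  move=> H1; apply: H; apply: H1 => u au.
    have [D _] := gcm n.+1 _ (lt_le_trans a_gt0 au).
    by apply: is_derive_eq; rewrite /GRing.scale/=; ring.
  by have := cm_sequence_le n.+2 gcm a_gt0 au; lra.
have as_ : a <= a + s by rewrite lerDl.
(* Up to the constant [g n a], this is the Taylor polynomial minus [g n]; its derivative is
   nonnegative by [le1]. *)
have := @is_derive1_ge0_le _ (fun t => - g n t - g n.+1 a * (t - a)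
    + g n.+2 a / 2 * (t - a) ^+ 2)
  (fun t => g n.+1 t - g n.+1 a + g n.+2 a * (t - a)) _ _ as_.
move=> H; suff /H {H}: forall t, a <= t -> is_derive t 1
   (fun t => - g n t - g n.+1 a * (t - a) + g n.+2 a / 2 * (t - a) ^+ 2)
   (g n.+1 t - g n.+1 a + g n.+2 a * (t - a)).
  move=> H.
  have {H}/H : forall t, a <= t -> 0 <= g n.+1 t - g n.+1 a + g n.+2 a * (t - a).
    by move=> t /le1; lra.
  have -> : a + s - a = s by ring.
  by rewrite subrr; lra.
move=> t at_.
have [D _] := gcm n _ (lt_le_trans a_gt0 at_).
by apply: is_derive_eq; rewrite /GRing.scale/=; field.
Qed.

(** The step [s = g n.+1 a / g n.+2 a] minimizes the Taylor polynomial. Keeping the value of [g n]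
    at [a + s] bounds the left side by a decrease of [g n], which becomes small at infinity. *)
Lemma cm_sequence_discriminant {g : nat -> R -> R} n {a : R} : cm_sequence g -> 0 < a ->
  g n.+1 a ^+ 2 / g n.+2 a <= 2 * (g n a - g n (a + g n.+1 a / g n.+2 a)).
Proof.
move=> gcm a_gt0.
have g1 := (gcm n.+1 a a_gt0).2; have g2 := (gcm n.+2 a a_gt0).2.
have := cm_sequence_taylor2 n gcm a_gt0 (ltW (divr_gt0 g1 g2)).
have -> : g n a - g n.+1 a * (g n.+1 a / g n.+2 a) +
    g n.+2 a * (g n.+1 a / g n.+2 a) ^+ 2 / 2 =
    g n a - (g n.+1 a ^+ 2 / g n.+2 a) / 2 by field; rewrite gt_eqF.
lra.
Qed.

End cm_sequence.

Section cm_sequence_log_convex.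
Context {R : realType} {g : nat -> R -> R}.
Hypothesis gcm : cm_sequence g.

Let g_gt0 n (t : R) : 0 < t -> 0 < g n t. Proof. by case/(gcm n t). Qed.

(* If [g_(n+2)^2 <= c g_(n+1) g_(n+3)], then [h = g_n - g_(n+1)^2 / (c' g_(n+2))]
   is nonincreasing for [c' = 2 - 1 / c], and it is nonnegative at infinity by
   [cm_sequence_discriminant]. *)
Lemma cm_sequence_step n (c : R) : 1 <= c ->
  (forall t : R, 0 < t -> g n.+2 t ^+ 2 <= c * (g n.+1 t * g n.+3 t)) ->
  forall a : R, 0 < a -> g n.+1 a ^+ 2 <= (2 - c^-1) * (g n a * g n.+2 a).
Proof.
move=> c_ge1 gc a a_gt0.
have c_gt0 : 0 < c by exact: lt_le_trans c_ge1.
have ci_gt0 : 0 < c^-1 by rewrite invr_gt0.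
have ci_le1 : c^-1 <= 1 by rewrite invf_le1.
set c' := 2 - c^-1; have c'_ge1 : 1 <= c' by rewrite /c'; lra.
have c'_gt0 : 0 < c' by exact: lt_le_trans c'_ge1.
pose h t := g n t - g n.+1 t ^+ 2 / g n.+2 t / c'.
(* The derivative of [- h]; with [c' = 2 - c^-1] the hypothesis [gc] makes its last factor
   nonnegative. *)
pose dh t := g n.+1 t / c' * (g n.+1 t * g n.+3 t / g n.+2 t ^+ 2 - c^-1).
have h_le b : a <= b -> h b <= h a.
  move=> ab; rewrite -lerN2.
  apply: (@is_derive1_ge0_le _ (fun t => - h t) dh _ _ ab)
    => t /(lt_le_trans a_gt0) t_gt0.
    have [D0 _] := gcm n _ t_gt0; have [D1 _] := gcm n.+1 _ t_gt0.
    have [D2 g2] := gcm n.+2 _ t_gt0.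
    have g2_neq0 : g n.+2 t != 0 by rewrite gt_eqF.
    have D2V := is_deriveV g2_neq0 D2.
    rewrite /h; apply: is_derive_eq; rewrite /GRing.scale/= /dh /c'.
    by field; rewrite g2_neq0 /=; lra.
  have [_ g1] := gcm n.+1 _ t_gt0; have [_ g2] := gcm n.+2 _ t_gt0.
  apply: mulr_ge0; first by rewrite divr_ge0 ?ltW.
  rewrite subr_ge0 ler_pdivlMr ?exprn_gt0//.
  by rewrite mulrC ler_pdivrMr// mulrC gc.
(* [L] plays the part of the limit of [g n] at infinity. *)
pose L := inf [set g n t | t in [set t : R | a <= t]].
have L_lb t : a <= t -> L <= g n t.
  move=> at_; apply: ge_inf; last by exists t.
  by exists 0 => _ [u au <-]; rewrite ltW// g_gt0// (lt_le_trans a_gt0).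
have L_ge0 : 0 <= L.
  apply: lb_le_inf; first by exists (g n a), a => /=.
  by move=> _ [u au <-]; rewrite ltW// g_gt0// (lt_le_trans a_gt0).
suff h_ge0 : 0 <= h a.
  move: h_ge0; rewrite /h subr_ge0 ler_pdivrMr// ler_pdivrMr ?g_gt0//.
  by rewrite -mulrA mulrCA.
(* From [h b <= h a < 0] comes [q >= g n b - h a], and the discriminant bound gives
   [q <= 2 * (g n b - L)]. As [L >= 0], this contradicts [g n b < L - h a]. *)
rewrite leNgt; apply/negP => h_lt0.
have [_ [b ab <-] gb] :
    exists2 y, [set g n t | t in [set t : R | a <= t]] y & y < L - h a.
  by apply: inf_lt; [exists (g n a), a => /=|rewrite -/L; lra].
have b_gt0 := lt_le_trans a_gt0 ab.
have g1 := g_gt0 n.+1 _ b_gt0; have g2 := g_gt0 n.+2 _ b_gt0.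
have := cm_sequence_discriminant n gcm b_gt0.
set q := g n.+1 b ^+ 2 / g n.+2 b.
have q_ge0 : 0 <= q by rewrite divr_ge0 ?exprn_ge0 ?ltW.
have : L <= g n (b + g n.+1 b / g n.+2 b).
  by apply: L_lb; rewrite (le_trans ab)// lerDl divr_ge0 ?ltW.
have := h_le b ab; rewrite {1}/h -/q.
have : q / c' <= q by rewrite ler_piMr// invf_le1.
by lra.
Qed.

(** The base constant 2 comes from dropping the positive subtracted term of
    [cm_sequence_discriminant]. The step at [n] uses the previous constant at [n.+1], so [n] stays
    general in the induction. *)
Lemma cm_sequence_iter m n {a : R} : 0 < a ->
  g n.+1 a ^+ 2 <= (m.+2%:R / m.+1%:R) * (g n a * g n.+2 a).
Proof.
elim: m n a => [|m IHm] n a a_gt0.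
  have g1 := g_gt0 n.+1 _ a_gt0; have g2 := g_gt0 n.+2 _ a_gt0.
  have gs : 0 < g n (a + g n.+1 a / g n.+2 a).
    by rewrite g_gt0// addr_gt0// divr_gt0.
  have := cm_sequence_discriminant n gcm a_gt0.
  rewrite ler_pdivrMr// => /le_trans; apply.
  by rewrite divr1 -mulrA ler_pM2l// ler_pM2r//; lra.
have -> : m.+3%:R / m.+2%:R = 2 - (m.+2%:R / m.+1%:R)^-1 :> R.
  by rewrite -!natr1; field; rewrite !natr1 !pnatr_eq0.
apply: cm_sequence_step => //.
  by rewrite ler_pdivlMr ?ltr0n// mul1r ler_nat.
by move=> t; exact: IHm.
Qed.

Lemma cm_sequence_sqr_le n {a : R} : 0 < a -> g n.+1 a ^+ 2 <= g n a * g n.+2 a.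
Proof.
move=> a_gt0; set p := g n a * g n.+2 a.
have p_gt0 : 0 < p by rewrite mulr_gt0 ?g_gt0.
rewrite leNgt; apply/negP => p_lt.
(* The relative excess: the square equals [(1 + e) * p], against the bound [(1 + 1 / (m + 1)) * p]
   for every [m]. *)
set e := (g n.+1 a ^+ 2 - p) / p.
have e_gt0 : 0 < e by rewrite divr_gt0// subr_gt0.
have [m m_e] : exists m, m.+1%:R^-1 < e.
  exists (Num.truncn e^-1); rewrite invf_plt ?posrE ?ltr0n//.
  by rewrite truncnS_gt.
have := cm_sequence_iter m n a_gt0; rewrite -/p.
have -> : m.+2%:R / m.+1%:R = 1 + m.+1%:R^-1 :> R.
  by rewrite -[m.+2]addn1 natrD mulrDl divff ?pnatr_eq0// mul1r.
rewrite leNgt => /negP; apply.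
have -> : g n.+1 a ^+ 2 = (1 + e) * p by rewrite /e; field; rewrite gt_eqF.
by rewrite ltr_pM2r// ltrD2l.
Qed.

(** [- (g 1 / g 0)] is the logarithmic derivative of [g 0], and the numerator of its own derivative
    is signed by [cm_sequence_sqr_le]. *)
Lemma cm_sequence_ratio_le {a b : R} : 0 < a -> a <= b ->
  - (g 1%N a / g 0%N a) <= - (g 1%N b / g 0%N b).
Proof.
move=> a_gt0 ab.
apply: (@is_derive1_ge0_le _ (fun t => - (g 1%N t / g 0%N t))
  (fun t => (g 0%N t * g 2%N t - g 1%N t ^+ 2) / g 0%N t ^+ 2) _ _ ab)
  => t /(lt_le_trans a_gt0) t_gt0.
  have [D0 g0] := gcm 0%N _ t_gt0; have [D1 _] := gcm 1%N _ t_gt0.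
  have g0_neq0 : g 0%N t != 0 by rewrite gt_eqF.
  have D0V := is_deriveV g0_neq0 D0.
  by apply: is_derive_eq; rewrite /GRing.scale/=; field.
by rewrite divr_ge0 ?exprn_ge0 ?subr_ge0 ?cm_sequence_sqr_le ?ltW ?g_gt0.
Qed.

Lemma cm_sequence_log_convex {a b d : R} : 0 < a -> a <= b -> 0 <= d ->
  g 0%N (a + d) * g 0%N b <= g 0%N a * g 0%N (b + d).
Proof.
move=> a_gt0 ab d_ge0.
have b_gt0 := lt_le_trans a_gt0 ab.
suff : g 0%N (a + d) / g 0%N a <= g 0%N (b + d) / g 0%N b.
  rewrite ler_pdivrMr ?g_gt0// mulrAC ler_pdivlMr ?g_gt0//.
  by rewrite mulrC [g 0%N a * _]mulrC mulrC.
apply: (@is_derive1_ge0_le _ (fun t => g 0%N (t + d) / g 0%N t)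
  (fun t => g 0%N (t + d) / g 0%N t *
    (- (g 1%N (t + d) / g 0%N (t + d)) + g 1%N t / g 0%N t)) _ _ ab)
  => t /(lt_le_trans a_gt0) t_gt0; have td_gt0 : 0 < t + d by rewrite ltr_wpDr.
  have g0_neq0 : g 0%N t != 0 by rewrite gt_eqF ?g_gt0.
  have g0d_neq0 : g 0%N (t + d) != 0 by rewrite gt_eqF ?g_gt0.
  have [D0 _] := gcm 0%N _ t_gt0; have D0V := is_deriveV g0_neq0 D0.
  have [D1 _] := gcm 0%N _ td_gt0.
  have Dd : is_derive t 1 (fun t => t + d) (1 : R).
    by apply: is_derive_eq; rewrite addr0.
  have DD := @is_derive1_comp _ _ (fun t => t + d) _ _ _ D1 Dd.
  apply: (@is_derive_eq _ _ _ ((g 0%N \o (fun t => t + d)) * (fun t => (g 0%N t)^-1))).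
  by rewrite /GRing.scale/=; field; rewrite g0_neq0 g0d_neq0.
apply: mulr_ge0; first by rewrite divr_ge0 ?ltW ?g_gt0.
by rewrite addrC subr_ge0 -lerN2 cm_sequence_ratio_le// lerDl.
Qed.

End cm_sequence_log_convex.

(** * Completely monotone kernels, including the endpoint 0 *)

Section completely_monotone_kernel.
Context {R : realType} {G : R -> R}.
Hypotheses (Gcm : completely_monotone_kernel G) (G0_gt0 : 0 < G 0).

(** Since [expR (- t)] equals all its signed derivatives, this is the sequence attached to
    [G t + e * expR (- t)]. *)
Let perturb (e : R) n (t : R) : R := (- 1) ^+ n * derive1n n G t + e * expR (- t).

Lemma cm_sequence_perturb {e : R} : 0 < e -> cm_sequence (perturb e).
Proof.
move=> e_gt0 n t t_gt0; split; last first.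
  by rewrite ltr_wpDl ?mulr_gt0 ?expR_gt0// (Gcm.1 n t t_gt0).2.
have [/derivableP D _] := Gcm.1 n t t_gt0.
have -> : - perturb e n.+1 t = (- 1) ^+ n * derive1n n.+1 G t - e * expR (- t).
  by rewrite /perturb exprS; ring.
have DN : is_derive t 1 (fun t : R => - t) (- 1 : R) by apply: is_derive_eq.
have DE := is_derive1_comp (is_derive_expR (- t)) DN.
rewrite derive1nS derive1E; apply: (@is_derive_eq _ _ _
  (fun t => (- 1) ^+ n * derive1n n G t + e * (expR \o -%R) t)).
by rewrite /GRing.scale/=; ring.
Qed.

Lemma cm_log_convex_pos {a b d : R} : 0 < a -> a <= b -> 0 <= d ->
  G (a + d) * G b <= G a * G (b + d).
Proof.
move=> a_gt0 ab d_ge0.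
have pert e : 0 < e ->
    (G (a + d) + e * expR (- (a + d))) * (G b + e * expR (- b)) <=
    (G a + e * expR (- a)) * (G (b + d) + e * expR (- (b + d))).
  move=> /cm_sequence_perturb/cm_sequence_log_convex - /(_ _ _ _ a_gt0 ab d_ge0).
  by rewrite /perturb expr0 !mul1r.
have cvg s : G s + e * expR (- s) @[e --> 0^'+] --> G s.
  rewrite -[X in _ --> X]addr0 -[X in _ --> _ + X](mul0r (expR (- s))).
  by apply: cvg_at_right_filter; apply: cvgD;
    [exact: cvg_cst|apply: cvgMl; exact: cvg_id].
apply: (ler_cvg_to (cvgM (cvg (a + d)) (cvg b)) (cvgM (cvg a) (cvg (b + d)))).
by near=> e; apply: pert; near: e; exact: nbhs_right_gt.
Unshelve. all: by end_near. Qed.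

Lemma cm_cvg {t : R} : 0 <= t -> G (t + e) @[e --> 0^'+] --> G t.
Proof.
rewrite le_eqVlt => /predU1P[<-|t_gt0].
  by under eq_fun do rewrite add0r; exact: Gcm.2.
have [/derivable1_diffP/differentiable_continuous Gt _] := Gcm.1 0%N t t_gt0.
have t_cvg : t + e @[e --> (0 : R)] --> t.
  rewrite -[X in _ --> X]addr0.
  by apply: cvgD; [exact: cvg_cst|exact: cvg_id].
by apply: cvg_at_right_filter; exact: (cvg_comp _ _ t_cvg Gt).
Qed.

(** Translating [a] and [b] by [e > 0] leads to positive arguments; right continuity on [[0, +oo[]
    then allows [e] to tend to 0. *)
Lemma cm_log_convex : log_convex G.
Proof.
move=> a b d a_ge0 ab d_ge0.
have b_ge0 := le_trans a_ge0 ab.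
have ad_ge0 : 0 <= a + d by rewrite addr_ge0.
have bd_ge0 : 0 <= b + d by rewrite addr_ge0.
apply: (ler_cvg_to (cvgM (cm_cvg ad_ge0) (cm_cvg b_ge0))
  (cvgM (cm_cvg a_ge0) (cm_cvg bd_ge0))).
near=> e; have e_gt0 : 0 < e by near: e; exact: nbhs_right_gt.
have ae_gt0 : 0 < a + e by rewrite ltr_wpDl.
have : a + e <= b + e by rewrite lerD2r.
by move=> /(cm_log_convex_pos ae_gt0)/(_ d_ge0); rewrite !(addrAC _ e d).
Unshelve. all: by end_near. Qed.

Lemma cm_ge0 (t : R) : 0 <= t -> 0 <= G t.
Proof.
rewrite le_eqVlt => /predU1P[<-|/(Gcm.1 0%N) [_]]; first exact: ltW.
by rewrite expr0 mul1r.
Qed.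

(* Log-convexity on [0, t / 2, t] propagates a zero at [t] to [t / 2], hence
   to points arbitrarily close to [0], where [G] is positive. *)
Lemma cm_gt0 (t : R) : 0 <= t -> 0 < G t.
Proof.
rewrite le_eqVlt => /predU1P[<-//|t_gt0].
rewrite lt_neqAle eq_sym cm_ge0 ?ltW// andbT; apply/eqP => Gt0.
have half n : G (t / 2 ^+ n) = 0.
  elim: n => [|n IHn]; first by rewrite expr0 divr1.
  have s_ge0 : 0 <= t / 2 ^+ n.+1 by rewrite divr_ge0 ?exprn_ge0 ?ltW.
  have := cm_log_convex _ _ _ (lexx 0) s_ge0 s_ge0.
  have -> : t / 2 ^+ n.+1 + t / 2 ^+ n.+1 = t / 2 ^+ n.
    by rewrite exprS; field; rewrite expf_neq0.
  rewrite add0r IHn mulr0 -expr2 => G2_le0.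
  by apply/eqP; rewrite -sqrf_eq0 eq_le G2_le0 sqr_ge0.
have : \forall s \near 0^'+, 0 < G s by exact: (cvgr_gt _ Gcm.2).
case=> /= r r_gt0 near0.
have [n n_r] : exists n, t / 2 ^+ n < r.
  (* This [n] exceeds [t / r], and [n < 2 ^ n]. *)
  exists (Num.truncn (t / r)).+1; rewrite ltr_pdivrMr ?exprn_gt0// mulrC -ltr_pdivrMr//.
  rewrite (lt_trans (truncnS_gt _))// -natrX ltr_nat.
  exact: ltn_expl.
have s_gt0 : 0 < t / 2 ^+ n by rewrite divr_gt0 ?exprn_gt0.
have : 0 < G (t / 2 ^+ n).
  by apply: near0 => //=; rewrite sub0r normrN gtr0_norm.
by rewrite half ltxx.
Qed.

End completely_monotone_kernel.

Theorem theorem2p11 (R : realType) :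
  [/\ forall G : R -> R,
        completely_monotone_kernel G -> 0 < G 0 -> preserves_nonneg G,
      forall (mu : {finite_measure set (measurableTypeR R) -> \bar R})
          (G : R -> R),
        mu setT <> 0%E -> laplace_kernel mu G -> preserves_nonneg G
    & forall (mu : {finite_measure set (measurableTypeR R) -> \bar R})
          (G : R -> R),
        mu setT <> 0%E -> laplace_kernel mu G -> ~ concentrated_at_point mu ->
        forall (K : nat) (x t : 'I_K.+1 -> R),
          increasing_times t -> 0 < x ord0 -> nonneg_at_times G x t ->
          forall s : R, t ord0 < s ->
            (forall k : 'I_K.+1, k != ord0 -> s != t k) ->
            0 < kernel_sum G x t s].
Proof.
split.
- move=> G Gcm G0_gt0; apply: log_convex_preserves_nonneg.
    exact: cm_gt0.
  exact: cm_log_convex.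
- move=> mu G mu_neq0 muG; apply: log_convex_preserves_nonneg.
    by move=> t; exact: (laplace_gt0 mu_neq0 muG).
  exact: (laplace_log_convex mu_neq0 muG).
- move=> mu G mu_neq0 muG mu_nc K x t t_incr x0_gt0 y_ge0 s t0s s_neq.
  have G_gt0 u : 0 <= u -> 0 < G u by exact: (laplace_gt0 mu_neq0 muG).
  have Glc := laplace_log_convex mu_neq0 muG.
  have [_] := log_convex_kernel_sum G_gt0 Glc s t_incr y_ge0.
  by apply=> //; exact: (laplace_strictly_log_convex mu_neq0 muG).
Qed.
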